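(* Let $X$ be a metric space, let $G$ be a topological subgroup of $\mathrm{Iso}(X)$, and let $\mathscr{A}$ be a $G$-attractive and approximately $G$-invariant filter on $X$. If $G$ is $\mathscr{A}$-approximated by some discretely amenable subgroup, then $G$ is skew-amenable.
   Context: For a topological group $G$ and $g\in G$ let $\lambda_g\colon G\to G,\ x\mapsto gx$. $\mathrm{LUCB}(G)$ is the algebra of bounded functions $f\colon G\to\mathbb{R}$ that are left-uniformly continuous, i.e., for every $\epsilon>0$ there is a neighborhood $U$ of the neutral element with $|f(x)-f(y)|\le\epsilon$ whenever $x^{-1}y\in U$. A mean on $\mathrm{LUCB}(G)$ is a positive linear functional $\mu$ with $\mu(\mathbf 1)=1$. $G$ is skew-amenable if $\mathrm{LUCB}(G)$ admits a mean $\mu$ with $\mu(f\circ\lambda_g)=\mu(f)$ for all $f\in\mathrm{LUCB}(G)$, $g\in G$. A subgroup is discretely amenable if it is amenable as a discrete group. $\mathrm{Iso}(X)$ is the group of all (bijective) isometries of the metric space $(X,d_X)$ with the topology of pointwise convergence with respect to the metric; a topological subgroup carries the subspace topology. For $A\subseteq X$ and $\epsilon>0$ let $B_X(A,\epsilon)=\{x\in X\mid\exists a\in A\colon d_X(x,a)<\epsilon\}$. For $G\leq\mathrm{Iso}(X)$: - a subset $A\subseteq X$ is $G$-attractive if for every $\epsilon>0$ and every finite $F\subseteq X$ there is $g\in G$ with $g(F)\subseteq B_X(A,\epsilon)$; - a filter $\mathscr{A}$ on $X$ is $G$-attractive if every member of $\mathscr{A}$ is $G$-attractive; - a filter $\mathscr{A}$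 on $X$ is approximately $G$-invariant if $B_X(g(A),\epsilon)\in\mathscr{A}$ for all $A\in\mathscr{A}$, $g\in G$ and $\epsilon>0$; - $G$ is $\mathscr{A}$-approximated by a subgroup $K\leq G$ if for every $g\in G$ there is $h\in K$ such that for every $\epsilon>0$ there is $A\in\mathscr{A}$ with $\sup_{x\in A}d_X(gx,hx)<\epsilon$. *)

(* Defs.v *)
From HB Require Import structures.
From mathcomp Require Import all_boot all_order all_algebra.
From mathcomp Require Import all_classical all_reals all_analysis.

Set Implicit Arguments.
Unset Strict Implicit.
Unset Printing Implicit Defensive.

Import Order.TTheory GRing.Theory Num.Theory.
Import numFieldNormedType.Exports.

Local Open Scope classical_set_scope.
Local Open Scope ring_scope.

HB.mixin Record isTopologicalGroup G of Topological G & Group G := {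
  mulg_continuous : continuous (fun x : G * G => x.1 * x.2)%g;
  invg_continuous : continuous (fun x : G => x^-1)%g
}.

#[short(type="topologicalGroupType")]
HB.structure Definition TopologicalGroup :=
  {G of Topological G & Group G & isTopologicalGroup G}.

Definition subgroup_type (T : groupType) (S : groupClosed T) : Type :=
  {x : T | x \in S}.

Section subgroup_group.
Variables (T : groupType) (S : groupClosed T).
Local Notation H := (subgroup_type S).

HB.instance Definition _ := SubChoice.on H.

Let inH v (Sv : v \in S) : H := exist _ v Sv.
Let one : H := inH gpred1.
Let inv (u : H) : H := inH (gpredVr _ (valP u)).
Let mul (u v : H) : H := inH (gpredM _ _ (valP u) (valP v)).

Let mulA : associative mul.
Proof. by move=> x y z; apply: val_inj; rewrite /= mulgA. Qed.
Let mul1 : left_id one mul.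
Proof. by move=> x; apply: val_inj; rewrite /= mul1g. Qed.
Let mulr1 : right_id one mul.
Proof. by move=> x; apply: val_inj; rewrite /= mulg1. Qed.
Let mulV : left_inverse one inv mul.
Proof. by move=> x; apply: val_inj; rewrite /= mulVg. Qed.
Let mulrV : right_inverse one inv mul.
Proof. by move=> x; apply: val_inj; rewrite /= mulgV. Qed.

HB.instance Definition _ := isGroup.Build H mulA mul1 mulr1 mulV mulrV.

Lemma val_subgroup1 : val (1%g : H) = 1%g. Proof. by []. Qed.

Lemma val_subgroupM (x y : H) : val (x * y)%g = (val x * val y)%g.
Proof. by []. Qed.

Lemma val_subgroupV (x : H) : val (x^-1)%g = (val x)^-1%g.
Proof. by []. Qed.
End subgroup_group.

Section subgroup_topology.
Variables (T : topologicalGroupType) (S : groupClosed T).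
Local Notation H := (subgroup_type S).

HB.instance Definition _ :=
  Topological.copy H (initial_topology (val : H -> T)).

Let val_continuous : continuous (val : H -> T).
Proof. exact: initial_continuous. Qed.

Let mul_continuous : continuous (fun x : H * H => x.1 * x.2)%g.
Proof.
apply: continuous_comp_initial => -[x y].
have valxy : (val u.1, val u.2) @[u --> (x, y)] --> (val x, val y).
  apply: cvg_pair => /=.
    by apply: cvg_comp; [exact: cvg_fst|exact: val_continuous].
  by apply: cvg_comp; [exact: cvg_snd|exact: val_continuous].
by have := cvg_comp _ _ valxy (@mulg_continuous T (val x, val y)).
Qed.

Let inv_continuous : continuous (fun x : H => x^-1)%g.
Proof.
apply: continuous_comp_initial => x.
by have := cvg_comp _ _ (@val_continuous x) (@invg_continuous T (val x)).
Qed.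

HB.instance Definition _ :=
  isTopologicalGroup.Build H mul_continuous inv_continuous.
End subgroup_topology.

Section isometry_group.
Context {R : realType} (X : metricType R).

Definition isometries : set (X -> X) :=
  [set g | bijective g /\ forall x y, mdist (g x) (g y) = mdist x y].

Definition Iso : Type := {g : X -> X | g \in isometries}.

Definition iso_fun (g : Iso) : X -> X := val g.

HB.instance Definition _ := SubChoice.on Iso.

Let isoP (g : Iso) : isometries (iso_fun g).
Proof. exact/set_mem/(valP g). Qed.

Let mkIso f (If : f \in isometries) : Iso := exist _ f If.

Let one_subproof : @id X \in isometries.
Proof. by apply/mem_set; split=> //; exists id. Qed.
Let one : Iso := mkIso one_subproof.

Let mul_subproof (g h : Iso) : iso_fun g \o iso_fun h \in isometries.
Proof.
have [bg ig] := isoP g; have [bh ih] := isoP h.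
by apply/mem_set; split=> [|x y /=]; [exact: bij_comp|rewrite ig ih].
Qed.
Let mul (g h : Iso) : Iso := mkIso (mul_subproof g h).

Let bij_exists (f : X -> X) :
  bijective f -> exists f', cancel f f' /\ cancel f' f.
Proof. by case=> f' fK f'K; exists f'. Qed.

Let inv_fun (g : Iso) : X -> X := sval (cid (bij_exists (isoP g).1)).
Let inv_funK (g : Iso) : cancel (iso_fun g) (inv_fun g).
Proof. by rewrite /inv_fun; case: cid => f []. Qed.
Let inv_funVK (g : Iso) : cancel (inv_fun g) (iso_fun g).
Proof. by rewrite /inv_fun; case: cid => f []. Qed.

Let inv_subproof (g : Iso) : inv_fun g \in isometries.
Proof.
apply/mem_set; split=> [|x y]; first by exists (iso_fun g).
by rewrite -(isoP g).2 !inv_funVK.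
Qed.
Let inv (g : Iso) : Iso := mkIso (inv_subproof g).

Let mulA : associative mul.
Proof. by move=> x y z; apply: val_inj. Qed.
Let mul1 : left_id one mul.
Proof. by move=> x; apply: val_inj. Qed.
Let mulr1 : right_id one mul.
Proof. by move=> x; apply: val_inj. Qed.
Let mulV : left_inverse one inv mul.
Proof. by move=> g; apply: val_inj; apply/funext; exact: inv_funK. Qed.
Let mulrV : right_inverse one inv mul.
Proof. by move=> g; apply: val_inj; apply/funext; exact: inv_funVK. Qed.

HB.instance Definition _ := isGroup.Build Iso mulA mul1 mulr1 mulV mulrV.

Lemma iso_fun1 : iso_fun 1%g = id. Proof. by []. Qed.

Lemma iso_funM (g h : Iso) : iso_fun (g * h)%g = iso_fun g \o iso_fun h.
Proof. by []. Qed.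

Lemma iso_funK (g : Iso) : cancel (iso_fun g) (iso_fun g^-1%g).
Proof. exact: inv_funK. Qed.

Lemma iso_funVK (g : Iso) : cancel (iso_fun g^-1%g) (iso_fun g).
Proof. exact: inv_funVK. Qed.

Lemma iso_mdist (g : Iso) (x y : X) :
  mdist (iso_fun g x) (iso_fun g y) = mdist x y.
Proof. exact: (isoP g).2. Qed.

HB.instance Definition _ :=
  Topological.copy Iso (initial_topology (iso_fun : Iso -> {ptws X -> X})).

Lemma iso_cvgP (F : set_system Iso) (FF : Filter F) (g : Iso) :
  F --> g <-> forall x, iso_fun h x @[h --> F] --> iso_fun g x.
Proof.
have ptwsP := @pointwise_cvgP X X (iso_fun @ F) (iso_fun g) (fmap_filter _ FF).
apply: iff_trans ptwsP.
split=> [Fg|Fg].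
  exact: cvg_comp _ _ Fg (@initial_continuous _ {ptws X -> X} iso_fun g).
move=> U [? /= [[W oW <-]]] /= Wg /filterS; apply; apply: Fg.
exact: open_nbhs_nbhs.
Qed.

Import metricType_numDomainType.

Let mul_continuous : continuous (fun x : Iso * Iso => x.1 * x.2)%g.
Proof.
move=> -[g h]; apply/iso_cvgP => x /=; apply/cvgrPdist_lt => e e0.
have gh : \forall k \near g, mdist (iso_fun g (iso_fun h x))
    (iso_fun k (iso_fun h x)) < e / 2.
  have /iso_cvgP/(_ (iso_fun h x))/cvgrPdist_lt := @cvg_id _ (nbhs g).
  by apply; rewrite divr_gt0.
have hx : \forall k \near h, mdist (iso_fun h x) (iso_fun k x) < e / 2.
  have /iso_cvgP/(_ x)/cvgrPdist_lt := @cvg_id _ (nbhs h).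
  by apply; rewrite divr_gt0.
exists ([set k | mdist (iso_fun g (iso_fun h x))
    (iso_fun k (iso_fun h x)) < e / 2],
  [set k | mdist (iso_fun h x) (iso_fun k x) < e / 2]) => //= -[k l] /= [gk hl].
rewrite (splitr e) (le_lt_trans (metric_triangle _ (iso_fun k (iso_fun h x)) _))//.
by rewrite ltrD// iso_mdist.
Qed.

Let inv_continuous : continuous (fun g : Iso => g^-1)%g.
Proof.
move=> g; have FF := nbhs_filter g.
apply/(@iso_cvgP _ (fmap_filter _ FF)) => x /=; apply/cvgrPdist_lt => e e0.
have /iso_cvgP/(_ (iso_fun g^-1%g x))/cvgrPdist_lt/(_ e e0) :=
  @cvg_id _ (nbhs g).
apply: filterS => k; rewrite iso_funVK => xk /=.
by rewrite -(iso_mdist k) iso_funVK metric_sym.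
Qed.

HB.instance Definition _ :=
  isTopologicalGroup.Build Iso mul_continuous inv_continuous.

End isometry_group.

Section amenability.
Variable R : realType.

(* A functional is represented by a total [mu : (G -> R) -> R] of which only
   the restriction to the function space [E] is relevant. *)
Definition is_mean (G : Type) (E : set (G -> R)) (mu : (G -> R) -> R) : Prop :=
  [/\ forall (a : R) (f g : G -> R), E f -> E g ->
        mu (fun x => a * f x + g x) = a * mu f + mu g,
      forall f : G -> R, E f -> (forall x, 0 <= f x) -> 0 <= mu f
    & mu (fun=> 1) = 1].

Definition left_invariant (G : groupType) (E : set (G -> R))
    (mu : (G -> R) -> R) : Prop :=
  forall (f : G -> R) (g : G), E f -> mu (fun x => f (g * x)%g) = mu f.

Definition left_uniformly_continuous (G : topologicalGroupType)
    (f : G -> R) : Prop :=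
  forall eps : R, 0 < eps -> exists2 U : set G, nbhs 1%g U &
    forall x y : G, U (x^-1 * y)%g -> `|f x - f y| <= eps.

Definition LUCB (G : topologicalGroupType) : set (G -> R) :=
  [set f : G -> R | bounded_fun (f : G -> R^o) /\ left_uniformly_continuous f].

Definition skew_amenable (G : topologicalGroupType) : Prop :=
  exists mu : (G -> R) -> R,
    is_mean (@LUCB G) mu /\ left_invariant (@LUCB G) mu.

Definition ell_infty (G : Type) : set (G -> R) :=
  [set f : G -> R | bounded_fun (f : G -> R^o)].

(* Left-invariant means on all bounded functions, i.e. amenability of [G] as a
   discrete group. *)
Definition discretely_amenable (G : groupType) : Prop :=
  exists mu : (G -> R) -> R,
    is_mean (@ell_infty G) mu /\ left_invariant (@ell_infty G) mu.

End amenability.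

Section attraction.
Context {R : realType} {X : metricType R}.
Implicit Types (A : set X) (F : set_system X) (G K : groupClosed (Iso X)).

Definition set_ball A (eps : R) : set X :=
  [set x | exists2 a, A a & mdist x a < eps].

Definition attractive G A : Prop :=
  forall eps : R, 0 < eps -> forall E : set X, finite_set E ->
    exists2 g : Iso X, g \in G & iso_fun g @` E `<=` set_ball A eps.

Definition attractive_filter G F : Prop := forall A, F A -> attractive G A.

Definition approx_invariant G F : Prop :=
  forall A (g : Iso X) (eps : R), F A -> g \in G -> 0 < eps ->
    F (set_ball (iso_fun g @` A) eps).

(* The supremum is taken in the extended reals: it may be infinite. *)
Definition approximated G F K : Prop :=
  forall g : Iso X, g \in G -> exists2 h : Iso X, h \in K &
    forall eps : R, 0 < eps -> exists2 A, F A &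
      (ereal_sup [set (mdist (iso_fun g x) (iso_fun h x))%:E | x in A]
         < eps%:E)%E.

End attraction.

(* Main.v *)
Require Import Defs.
From HB Require Import structures.
From mathcomp Require Import all_boot all_order all_algebra.
From mathcomp Require Import all_classical all_reals all_analysis.

(** Let [t] run through [G] along the filter generated by the sets of those [t]
    that move a prescribed finite set [E] into a prescribed ball around a member
    [A] of [F] ([attraction_filter]); attractiveness says that these sets are
    nonempty.  Refine this filter to an ultrafilter [U], and let [nu] be a left
    invariant mean on the bounded functions on [K].  The required mean is

       mu f  =  nu (k |-> lim_(t -> U) f (k t)).

    It is invariant under left translation by [K] because [nu] is.  For [g] in
    [G], let [h] in [K] be an element that approximates [g] along [F].  For
    each fixed [k] in [K], approximate invariance of [F] shows that not only
    [t x] but also [k t x] is eventually close to any given member of [F], where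
    [g] and [h] nearly agree; hence [g k t x] and [h k t x] become arbitrarily
    close, for every point [x].  In the topology of pointwise convergence this
    says that the quotient of [g k t] and [h k t] tends to [1], so by left
    uniform continuity [f (g k t)] and [f (h k t)] have the same limit.
    Therefore [mu (f o lambda_g) = mu (f o lambda_h) = mu f].

    The limit over [t] has to be taken inside [nu]: the closeness of [g k t x]
    and [h k t x] is only eventual in [t], with no uniformity in [k].
    [skew_amenable_of_asymptotic] isolates the averaging argument for arbitrary
    topological groups; [attraction_filter_near_translate] is the geometric
    input. *)

Set Implicit Arguments.
Unset Strict Implicit.
Unset Printing Implicit Defensive.

Import Order.TTheory GRing.Theory Num.Theory.
Import numFieldNormedType.Exports.
Import metricType_numDomainType.

Local Open Scope classical_set_scope.
Local Open Scope ring_scope.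

Lemma bounded_funP (R : realType) (T : Type) (f : T -> R) :
  bounded_fun (f : T -> R^o) <-> exists M : R, forall x, `|f x| <= M.
Proof.
split=> [/pinfty_ex_gt0[M _ fM]|[M fM]]; first by exists M => x; exact: fM.
exists M; split=> [|N MN x _]; first exact: num_real.
by apply: le_trans (fM x) _; exact: ltW.
Qed.

(** The values stay in a compact segment, so the image filter has a cluster
    point; along an ultrafilter a cluster point is a limit. *)
Lemma ultra_bounded_cvg (R : realType) (T : Type) (U : set_system T)
    (f : T -> R) :
  UltraFilter U -> bounded_fun (f : T -> R^o) -> cvg (f @ U).
Proof.
move=> UU /bounded_funP[M fM]; have PU := @ultra_proper _ _ UU.
have fUM : (f @ U) [set` `[- M, M]].
  by apply: (@filterE _ U) => x /=; rewrite in_itv/= -ler_norml.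
have [p [_ clp]] := @segment_compact R (- M) M (f @ U) _ fUM.
apply/cvg_ex; exists p => N Np.
have [//|UN] := in_ultra_setVsetC (f @^-1` N) UU.
by have [y []] := clp (~` N) N UN Np.
Qed.

(** If every [g] in [G] can be replaced by an element of the amenable group [K]
    without asymptotic effect along [W], after translation by any element of [K],
    then averaging over [K] the limits along an ultrafilter finer than [W] gives
    a mean invariant under all of [G].  The quotient is formed as
    [x^-1 * y] because this is the one that left uniform continuity controls. *)
Lemma skew_amenable_of_asymptotic (R : realType) (G : topologicalGroupType)
    (K : groupType) (i : K -> G) (W : set_system G) :
  (forall h k, i (h * k)%g = (i h * i k)%g) -> ProperFilter W ->
  (forall g : G, exists h : K, forall k : K,
    ((g * i k * t)^-1 * (i h * i k * t))%g @[t --> W] --> (1 : G)%g) ->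
  discretely_amenable R K -> skew_amenable R G.
Proof.
move=> iM PW asym [nu [[nuL nu_ge0 nu1] nu_inv]].
have [U [UU WU]] := ultraFilterLemma PW; have PU := @ultra_proper _ _ UU.
pose avg (f : G -> R) k : R := lim (f (i k * t)%g @[t --> U]).
have avg_cvg f k : bounded_fun (f : G -> R^o) -> cvg (f (i k * t)%g @[t --> U]).
  move=> /bounded_funP[M fM]; apply: ultra_bounded_cvg.
  by apply/bounded_funP; exists M => x.
have avg_bounded f : bounded_fun (f : G -> R^o) -> ell_infty (avg f).
  move=> bf; have /bounded_funP[M fM] := bf; apply/bounded_funP; exists M => k.
  rewrite ler_norml; apply/andP; split.
    apply: limr_ge; first exact: avg_cvg.
    by apply: filterE => t; have := fM (i k * t)%g; rewrite ler_norml => /andP[].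
  apply: limr_le; first exact: avg_cvg.
  by apply: filterE => t; have := fM (i k * t)%g; rewrite ler_norml => /andP[].
exists (fun f => nu (avg f)); split; first split.
- move=> a f g [bf _] [bg _]; rewrite -nuL; [|exact: avg_bounded..].
  congr nu; apply/funext => k; apply/cvg_lim => //.
  by apply: cvgD; [apply: cvgMl_tmp; exact: avg_cvg|exact: avg_cvg].
- move=> f [bf _] f0; apply: nu_ge0; first exact: avg_bounded.
  move=> k; apply: limr_ge; first exact: avg_cvg.
  exact: filterE.
- rewrite -[RHS]nu1; congr nu; apply/funext => k; exact: lim_cst.
- move=> f g [bf ucf]; have [h gh] := asym g.
  (* By invariance of [nu] it suffices that the averages of [f] translated by
     [g] and of [f] translated by [h] are the same function on [K]. *)
  rewrite -(nu_inv _ h (avg_bounded _ bf)); congr nu; apply/funext => k.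
  apply/cvg_lim => //; apply: cvg_sub0 (avg_cvg f (h * k)%g bf).
  apply/cvgr0Pnorm_le => e e0; have [V V1 fV] := ucf e e0.
  apply: WU; apply: (@filterS _ W _ _ _ _ (gh k V V1)) => t Vt.
  by rewrite !fctE iM !mulgA; apply: fV.
Qed.

Lemma subgroup_cvg (G : topologicalGroupType) (S : groupClosed G)
    (W : set_system (subgroup_type S)) (PW : Filter W) (s : subgroup_type S) :
  val t @[t --> W] --> val s -> W --> s.
Proof.
move=> Ws U [? /= [[V oV <-]]] /= Vs /filterS; apply; apply: Ws.
exact: open_nbhs_nbhs.
Qed.

Section attraction_filter.
Context {R : realType} {X : metricType R}.
Variables (G : groupClosed (Iso X)) (F : set_system X).

Definition attraction_filter : set_system (subgroup_type G) :=
  filter_from [set EAe : set X * set X * R |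
      [/\ finite_set EAe.1.1, F EAe.1.2 & 0 < EAe.2]]
    (fun EAe => [set t | iso_fun (val t) @` EAe.1.1 `<=`
                         set_ball EAe.1.2 EAe.2]).

Lemma attraction_filter_proper :
  Filter F -> attractive_filter G F -> ProperFilter attraction_filter.
Proof.
move=> FF attr; apply: filter_from_proper; last first.
  move=> [[E A] e] [/= fE FA e0]; have [g Gg gE] := attr A FA e e0 E fE.
  by exists (exist _ g Gg).
apply: filter_from_filter.
  by exists (set0, setT, 1); split=> //; exact: filterT.
move=> [[E A] e] [[E' A'] e'] [/= fE FA e0] [/= fE' FA' e'0].
exists (E `|` E', A `&` A', Num.min e e').
  split=> /=; [by rewrite finite_setU|exact: filterI|].
  by rewrite lt_min e0 e'0.
move=> t /= tE; split=> _ [x Ex <-].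
  have [|a [Aa _] xa] := tE (iso_fun (val t) x).
    by exists x => //; left.
  by exists a => //; apply: lt_le_trans xa _; rewrite ge_min lexx.
have [|a [_ Aa] xa] := tE (iso_fun (val t) x).
  by exists x => //; right.
by exists a => //; apply: lt_le_trans xa _; rewrite ge_min lexx orbT.
Qed.

Lemma attraction_filter_near (x : X) (A : set X) (e : R) : F A -> 0 < e ->
  \forall t \near attraction_filter, set_ball A e (iso_fun (val t) x).
Proof.
move=> FA e0; exists ([set x], A, e) => [|t]; last by apply; exists x.
by split=> /=; first exact: finite_set1.
Qed.

(** If [t x] is close to a point [y] near [k^-1 a], then [k t x] is close to [a];
    and the ball around [k^-1 A] belongs to [F] by approximate invariance. *)
Lemma attraction_filter_near_translate (k : Iso X) (x : X) (A : set X)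
    (e : R) :
  Filter F -> attractive_filter G F -> approx_invariant G F ->
  k \in G -> F A -> 0 < e ->
  \forall t \near attraction_filter,
    set_ball A e (iso_fun k (iso_fun (val t) x)).
Proof.
move=> FF attr inv Gk FA e0; have PW := attraction_filter_proper FF attr.
have e20 : 0 < e / 2 by rewrite divr_gt0.
have FkA := inv A k^-1%g _ FA (gpredVr _ Gk) e20.
apply: filterS (attraction_filter_near x FkA e20) => t.
move=> [y [_ [a Aa <-] yka] txy]; exists a => //.
rewrite -(iso_mdist k^-1%g) iso_funK (splitr e).
by rewrite (le_lt_trans (metric_triangle _ y _))// ltrD.
Qed.

End attraction_filter.

Theorem corollary7p13 (R : realType) (X : metricType R)
    (G : groupClosed (Iso X)) (F : set_system X) :
  Filter F ->
  attractive_filter G F ->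
  approx_invariant G F ->
  (exists K : groupClosed (Iso X),
    [/\ {subset K <= G},
        discretely_amenable R (subgroup_type K)
      & approximated G F K]) ->
  skew_amenable R (subgroup_type G).
Proof.
move=> FF attr inv [K [KG amK appK]].
pose i (k : subgroup_type K) : subgroup_type G := exist _ (val k) (KG _ (valP k)).
have PW := attraction_filter_proper FF attr.
apply: (@skew_amenable_of_asymptotic _ _ _ i _ _ PW _ amK).
  by move=> h k; apply: val_inj.
move=> g; have [h Kh gh] := appK (val g) (valP g).
exists (exist _ h Kh) => k; apply: subgroup_cvg; apply/iso_cvgP => x.
apply/cvgrPdist_lt => e e0.
have e30 : 0 < e / 3 by rewrite divr_gt0.
have [A FA ghA] := gh _ e30.
have := attraction_filter_near_translate x FF attr inv (KG _ (valP k)) FA e30.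
apply: filterS => t [a Aa txa] /=.
have gha : mdist (iso_fun (val g) a) (iso_fun h a) < e / 3.
  by rewrite -lte_fin; apply: le_lt_trans ghA; apply: ereal_sup_ubound; exists a.
set y := iso_fun _ _ in txa.
set m := (val g * val k * val t)%g; set n := (h * val k * val t)%g.
(* Moving by the isometry [m] = [g k t] turns the distance from [x] to
   [m^-1 n x] into the distance from [g y] to [h y], where [y] = [k t x]. *)
rewrite -(iso_mdist m); change (mdist (iso_fun (val g) y)
  (iso_fun (m * (m^-1 * n))%g x) < e).
rewrite mulVKg; change (mdist (iso_fun (val g) y) (iso_fun h y) < e).
(* Compare along the path [g y], [g a], [h a], [h y]. *)
have -> : e = e / 3 + (e / 3 + e / 3).
  by rewrite addrA -!mulrDl -mulr2n -mulrSr -(mulr_natr e) mulfK.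
rewrite (le_lt_trans (metric_triangle _ (iso_fun (val g) a) _))//.
rewrite ltrD ?iso_mdist//.
rewrite (le_lt_trans (metric_triangle _ (iso_fun h a) _))//.
by rewrite ltrD// iso_mdist metric_sym.
Qed.
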